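(* There exists an integer $N$ such that for all integers $n\ge N$, $$0.666\, A(n,n,n)\le \operatorname{cr}(K_{n,n,n}),$$ where $$A(n_1,n_2,n_3)=\sum_{\substack{i=1,2,3\\ \{j,k\}=\{1,2,3\}\setminus \{i\}}}\left(\left\lfloor \frac{n_j}{2}\right\rfloor \left\lfloor \frac{n_j-1}{2}\right\rfloor \left\lfloor \frac{n_k}{2}\right\rfloor \left\lfloor \frac{n_k-1}{2}\right\rfloor +\left\lfloor \frac{n_i}{2}\right\rfloor \left\lfloor \frac{n_i-1}{2}\right\rfloor \left\lfloor \frac{n_j n_k}{2}\right\rfloor \right).$$
   Context: $K_{n,n,n}$ is the complete tripartite graph with three partite sets of size $n$. The sum defining $A$ has three terms, one for each $i\in\{1,2,3\}$, with $j,k$ the two remaining indices (each unordered pair $\{j,k\}$ counted once). A plane drawing of a graph is a good drawing if no more than two edges intersect at any point that is not a vertex, edges incident with a common vertex do not cross, no pair of edges cross more than once, and edges that intersect at a non-vertex must cross. The crossing number $\operatorname{cr}(D)$ of a good drawing $D$ is the number of non-vertex edge intersections in $D$. The crossing number of a graph $G$ is $\operatorname{cr}(G)=\min\{\operatorname{cr}(D): D \text{ is a good drawing of } G\}$. *)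

(* Defs.v *)
From HB Require Import structures.
From mathcomp Require Import all_boot all_order all_algebra.
From mathcomp Require Import all_classical all_reals all_analysis.
Set Implicit Arguments.
Unset Strict Implicit.
Unset Printing Implicit Defensive.
Import Order.TTheory GRing.Theory Num.Theory.
Import numFieldNormedType.Exports.
Local Open Scope classical_set_scope.
Local Open Scope ring_scope.

(* A simple graph on a finite type V is given by its symmetric irreflexive
   adjacency relation e; its edges are the two-element sets {u, v} with
   e u v. *)
Definition edges (V : finType) (e : rel V) : {set {set V}} :=
  [set [set p.1; p.2]%SET | p : V * V & e p.1 p.2]%SET.

Definition complete_tripartite (n : nat) : rel ('I_3 * 'I_n) :=
  fun u v => u.1 != v.1.

Notation plane R := (R * R)%type.

Definition is_arc (R : realType) (p q : plane R) (S : set (plane R)) : Prop :=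
  exists c : R -> plane R,
    [/\ {within `[0, 1], continuous c},
        {in `[0, 1] &, injective c},
        c 0 = p, c 1 = q & c @` `[0, 1] = S].

(* Topological (transversal) crossing: some homeomorphism phi from the plane
   onto an open neighbourhood of p, with phi 0 = p, pulls S1 and S2 back to the
   two coordinate axes.  In particular a tangency is not a crossing. *)
Definition crosses_at (R : realType) (S1 S2 : set (plane R)) (p : plane R) :
    Prop :=
  exists phi : plane R -> plane R,
    [/\ continuous phi, injective phi,
        (forall O : set (plane R), open O -> open (phi @` O)),
        phi (0, 0) = p &
        phi @^-1` S1 = [set x | x.2 = 0] /\ phi @^-1` S2 = [set x | x.1 = 0]].

(* [edge_curve E] is only meaningful when E is an edge. *)
Record drawing (R : realType) (V : finType) (e : rel V) := Drawing {
  vertex_point : V -> plane R;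
  edge_curve : {set V} -> set (plane R);
  vertex_point_inj : injective vertex_point;
  edge_curve_arc : forall u v : V, e u v ->
    is_arc (vertex_point u) (vertex_point v) (edge_curve [set u; v]%SET);
  edge_curve_vertex : forall (E : {set V}) (w : V), E \in edges e ->
    edge_curve E (vertex_point w) -> w \in E
}.

(* [meet_at D E F p]: the edges E and F intersect at the non-vertex p. *)
Definition meet_at (R : realType) (V : finType) (e : rel V)
    (D : drawing R e) (E F : {set V}) (p : plane R) : Prop :=
  [/\ E \in edges e, F \in edges e, E != F,
      ~ range (vertex_point D) p & edge_curve D E p /\ edge_curve D F p].

Definition cross_at (R : realType) (V : finType) (e : rel V)
    (D : drawing R e) (E F : {set V}) (p : plane R) : Prop :=
  meet_at D E F p /\ crosses_at (edge_curve D E) (edge_curve D F) p.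

Definition good_drawing (R : realType) (V : finType) (e : rel V)
    (D : drawing R e) : Prop :=
  [/\ (* no more than two edges intersect at a non-vertex *)
      (forall (E F G : {set V}) (p : plane R),
         meet_at D E F p -> meet_at D F G p -> E = G),
      (* edges incident with a common vertex do not cross *)
      (forall (E F : {set V}) (v : V) (p : plane R),
         v \in E -> v \in F -> ~ cross_at D E F p),
      (* no pair of edges cross more than once *)
      (forall (E F : {set V}) (p q : plane R),
         cross_at D E F p -> cross_at D E F q -> p = q) &
      (* edges that intersect at a non-vertex cross there *)
      (forall (E F : {set V}) (p : plane R),
         meet_at D E F p -> cross_at D E F p)].

Definition cr_drawing (R : realType) (V : finType) (e : rel V)
    (D : drawing R e) : \bar R :=
  counting [set p : plane R | exists E F, meet_at D E F p].

(* The minimum over good drawings: an infimum of a set of natural numbers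
   (in \bar R, so that no default value is needed for the empty set), hence
   attained. *)
Definition crossing_number (R : realType) (V : finType) (e : rel V) : \bar R :=
  ereal_inf [set cr_drawing D | D in @good_drawing R V e].

(* floor(m/2) * floor((m-1)/2); the truncation of 0.-1 is harmless since the
   other factor is then 0. *)
Definition half_prod (m : nat) : nat := (m./2 * m.-1./2)%N.

Definition A_term (ni nj nk : nat) : nat :=
  (half_prod nj * half_prod nk + half_prod ni * (nj * nk)./2)%N.

Definition A (n1 n2 n3 : nat) : nat :=
  (A_term n1 n2 n3 + A_term n2 n1 n3 + A_term n3 n1 n2)%N.

(* Main.v *)
(* Fix a partite set I.  If the stars joining three vertices of I to three
   vertices outside I were pairwise non-crossing, they would embed K_{3,3} in
   the plane; so, by Mantel's theorem, among the n stars with centres in I and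
   given leaves at least n^2/4 - O(n) pairs cross.  Taking two leaves in one
   of the remaining partite sets and one leaf in the other, each crossing is
   counted at most 2n + O(1) times over all choices of I and of the leaves,
   whether its four ends lie in two or in three partite sets.  Hence
   cr(K_{n,n,n}) >= (3/8) n^4 - O(n^3), while A(n,n,n) <= (9/16) n^4, and
   (3/8) / (9/16) = 2/3 > 0.666.

   K_{3,3} has no plane embedding because of a count modulo 2.  For disjoint
   arcs e, f the map (s, t) |-> e s - f t avoids 0 on the unit square, so the
   winding of e around the ends of f and that of f around the ends of e are
   linked by one parity relation.  Each winding number occurs in exactly two
   of the 18 relations given by the pairs of independent edges of K_{3,3}, and
   what is left of their sum is odd. *)
Require Import Defs.
From mathcomp Require Import all_boot all_order all_algebra.
From mathcomp Require Import all_classical all_reals all_analysis.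
From mathcomp Require Import finmap zify ring lra.
Set Implicit Arguments.
Unset Strict Implicit.
Unset Printing Implicit Defensive.
Import Order.TTheory GRing.Theory Num.Theory.
Import numFieldNormedType.Exports.
Local Open Scope classical_set_scope.
Local Open Scope ring_scope.

(** * Half-plane signs and crossings of the negative real axis *)

(* The tie-break on the real axis makes [upper (- z) = ~~ upper z] for all
   [z != 0]. *)
Definition upper (R : realType) (z : plane R) : bool :=
  (0 < z.2) || (z.2 == 0) && (0 < z.1).

(* Crossing of the negative real axis; testing only one of the two abscissae
   is sound for steps that are short compared with their distance to 0. *)
Definition ray_cross (R : realType) (z z' : plane R) : bool :=
  (upper z (+) upper z') && (z.1 < 0).

Lemma upperN (R : realType) (z : plane R) : z != 0 -> upper (- z) = ~~ upper z.
Proof.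
case: z => x y /eqP z0; rewrite /upper /= !oppr_gt0 oppr_eq0.
case: (ltgtP y 0) => //= y0; case: (ltgtP x 0) => //= x0.
by case: z0; rewrite x0 y0.
Qed.

(** Negating a step turns a crossing of the negative half-axis into one of the positive half-axis,
    and the two together make up the change of [upper]. *)
Lemma ray_crossN (R : realType) (z z' : plane R) : z != 0 -> z' != 0 ->
  (upper z != upper z' -> z.1 != 0) ->
  ray_cross (- z) (- z') = ray_cross z z' (+) upper z (+) upper z'.
Proof.
move=> z0 z'0 h; rewrite /ray_cross !upperN //= oppr_lt0.
by move: h; case: (upper z); case: (upper z') => //= /(_ isT); case: ltgtP.
Qed.

(* The radius is the max-norm of the centre: 0 lies on the boundary. *)
Definition in_ball (R : realType) (c z : plane R) : bool :=
  (`|c.1 - z.1| < Num.max `|c.1| `|c.2|) && (`|c.2 - z.2| < Num.max `|c.1| `|c.2|).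

(** For a fixed [b], crossings are either never counted or always equal to the change of [upper]; in
    both cases they cancel around a closed polygon. *)
Definition tame (R : realType) (b : bool) (z z' : plane R) : Prop :=
  [/\ ray_cross z z' = b && (upper z (+) upper z'), z != 0 &
    upper z != upper z' -> z.1 != 0].

(* The ball lies in an open half-plane bounded by a coordinate axis, so it
   misses one half of the real axis, or all of it. *)
Lemma ray_cross_ball (R : realType) (c : plane R) :
  exists b : bool, forall z z', in_ball c z -> in_ball c z' -> tame b z z'.
Proof.
have sgn (a x : R) : `|a - x| < `|a| ->
    [/\ (0 < x) = (0 < a), (x < 0) = (a < 0) & x != 0].
  rewrite ltr_norml; case: (ltrgt0P a) => a0 /andP[h1 h2]; last by lra.
    have x0 : 0 < x by lra.
    by rewrite x0 gt_eqF // ltNge ltW.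
  have x0 : x < 0 by lra.
  by rewrite x0 lt_eqF // ltNge ltW.
have nz (z : plane R) : (z.1 != 0) || (z.2 != 0) -> z != 0.
  by apply: contraTneq => ->; rewrite eqxx.
case: c => c1 c2; exists ((`|c2| < `|c1|) && (c1 < 0)) => z z'.
rewrite /tame /in_ball /ray_cross /=; case: (ltP `|c2| `|c1|) => h /=.
  by move=> /andP[/sgn[z1 z2 zn] _] _; rewrite z2 andbC nz ?zn.
move=> /andP[_ /sgn[z1 z2 zn]] /andP[_ /sgn[z'1 z'2 z'n]].
by rewrite /upper nz ?zn ?orbT // z1 z'1 (negPf zn) (negPf z'n) addbb eqxx.
Qed.

(** * Parity of winding for two disjoint arcs *)

(** A discrete Stokes formula modulo 2: each inner side belongs to two cells and cancels. *)
Lemma grid_boundary (h v : nat -> nat -> bool) (n m : nat) :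
  (forall i j, (i < n)%N -> (j < m)%N ->
     h i j (+) v i.+1 j = v i j (+) h i j.+1) ->
  \big[addb/false]_(i < n) h i 0%N (+) \big[addb/false]_(j < m) v n j =
  \big[addb/false]_(j < m) v 0%N j (+) \big[addb/false]_(i < n) h i m.
Proof.
elim: n => [|n IH] cell; first by rewrite !big_ord0 addbF.
have {}IH := IH (fun i j hi => cell i j (leqW hi)).
have col : h n 0%N (+) \big[addb/false]_(j < m) v n.+1 j =
           \big[addb/false]_(j < m) v n j (+) h n m.
  elim: m {IH} cell => [|m IHm] cell; first by rewrite !big_ord0 addbF.
  have {}IHm := IHm (fun i j hi hj => cell i j hi (leqW hj)).
  by rewrite !big_ord_recr /= addbA IHm -!addbA cell.
by rewrite !big_ord_recr /= -addbA col addbA IH addbA.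
Qed.

(* Parity of the winding of [e] around [w], read off a subdivision of [0, 1]
   into N + 1 equal steps. *)
Definition ray_index (R : realType) (N : nat) (e : R -> plane R) (w : plane R) :=
  \big[addb/false]_(i < N.+1)
     ray_cross (e (i%:R / N.+1%:R) - w) (e (i.+1%:R / N.+1%:R) - w).

(** The max-norm of [e s - f t] is positive because the two points differ; by continuity each curve
    moves by less than half of it near [s] and [t]. *)
Lemma local_ball (R : realType) (e f : R -> plane R) (s t : R) :
  {within `[0, 1], continuous e} -> {within `[0, 1], continuous f} ->
  s \in `[0, 1] -> t \in `[0, 1] -> e s != f t ->
  exists2 d : R, 0 < d & forall s' t', s' \in `[0, 1] -> t' \in `[0, 1] ->
    `|s - s'| < d -> `|t - t'| < d -> in_ball (e s - f t) (e s' - f t').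
Proof.
move=> /subspace_continuousP ce /subspace_continuousP cf s01 t01 neq.
set c := e s - f t.
set r := Num.max `|c.1| `|c.2|.
have r0 : 0 < r.
  rewrite lt_max !normr_gt0; apply: contraNT neq.
  rewrite negb_or !negbK -(subr_eq0 (e s)) -/c.
  by case: (c) => x y /= /andP[/eqP-> /eqP->].
have loc (g : R -> plane R) (x : R) : x \in `[0, 1] ->
    g @ within `[0, 1]%classic (nbhs x) --> g x ->
    exists2 d : R, 0 < d & forall x', x' \in `[0, 1] -> `|x - x'| < d ->
      `|(g x).1 - (g x').1| < r / 2 /\ `|(g x).2 - (g x').2| < r / 2.
  move=> x01 /cvgrPdist_lt /(_ (r / 2)).
  have r2 : 0 < r / 2 by rewrite divr_gt0.
  move=> /(_ r2); rewrite near_withinE => /nbhs_ballP[d /= d0 H].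
  exists d => // x' x'01 xd; have := H x' xd x'01.
  by rewrite prod_normE /= gt_max => /andP.
have [d1 d10 H1] := loc _ _ s01 (ce s s01).
have [d2 d20 H2] := loc _ _ t01 (cf t t01).
exists (Num.min d1 d2); first by rewrite lt_min d10.
move=> s' t' s'01 t'01; rewrite !lt_min => /andP[sd _] /andP[_ td].
have [{}H1 H1'] := H1 _ s'01 sd; have [{}H2 H2'] := H2 _ t'01 td.
have tri (a b a' b' : R) : `|a - a'| < r / 2 -> `|b - b'| < r / 2 ->
    `|a - b - (a' - b')| < r.
  by rewrite !ltr_norml => /andP[? ?] /andP[? ?]; lra.
by rewrite /in_ball -/r /= !tri.
Qed.

(** A Lebesgue number argument: by compactness of the unit square, one mesh size puts every grid
    cell into a ball that avoids 0. *)
Lemma cell_cross (R : realType) (e f : R -> plane R) :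
  {within `[0, 1], continuous e} -> {within `[0, 1], continuous f} ->
  (forall s t, s \in `[0, 1] -> t \in `[0, 1] -> e s != f t) ->
  \forall N \near \oo, forall s t, s \in `[0, 1] -> t \in `[0, 1] ->
    exists b : bool, forall s1 t1 s2 t2,
      s1 \in `[0, 1] -> t1 \in `[0, 1] -> s2 \in `[0, 1] -> t2 \in `[0, 1] ->
      `|s - s1| <= N.+1%:R^-1 -> `|t - t1| <= N.+1%:R^-1 ->
      `|s - s2| <= N.+1%:R^-1 -> `|t - t2| <= N.+1%:R^-1 ->
      tame b (e s1 - f t1) (e s2 - f t2).
Proof.
move=> ce cf disj.
have cK : compact ((`[0, 1] : set R) `*` (`[0, 1] : set R)).
  by apply: compact_setX; exact: segment_compact.
pose P (N : nat) (x : R * R) := exists b : bool, forall s1 t1 s2 t2,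
      s1 \in `[0, 1] -> t1 \in `[0, 1] -> s2 \in `[0, 1] -> t2 \in `[0, 1] ->
      `|x.1 - s1| <= N.+1%:R^-1 -> `|x.2 - t1| <= N.+1%:R^-1 ->
      `|x.1 - s2| <= N.+1%:R^-1 -> `|x.2 - t2| <= N.+1%:R^-1 ->
      tame b (e s1 - f t1) (e s2 - f t2).
suff : \forall N \near \oo, (`[0, 1] `*` `[0, 1]) `<=` P N.
  by apply: filterS => N H s t hs ht; exact: (H (s, t) (conj hs ht)).
move/compact_near_coveringP: cK; apply => -[s t] [/= hs ht].
have [d d0 H] := local_ball ce cf hs ht (disj _ _ hs ht).
have [b Hb] := ray_cross_ball (e s - f t).
(* One half of [d] is for the distance from [(s, t)] to [x], the other for the mesh. *)
have d2 : 0 < d / 2 by rewrite divr_gt0.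
near=> x N => /=; exists b => s1 t1 s2 t2 h1 h2 h3 h4 k1 k2 k3 k4.
have Nd : N.+1%:R^-1 < d / 2 :> R
  by near: N; exact: (near_infty_natSinv_lt (PosNum d2)).
have [xs xt] : `|s - x.1| < d / 2 /\ `|t - x.2| < d / 2.
  by near: x; apply: (nbhsx_ballx (s, t) _ d2).
apply: Hb; apply: H => //.
- by rewrite (le_lt_trans (ler_distD x.1 _ _)) // [d]splitr ltrD // (le_lt_trans k1).
- by rewrite (le_lt_trans (ler_distD x.2 _ _)) // [d]splitr ltrD // (le_lt_trans k2).
- by rewrite (le_lt_trans (ler_distD x.1 _ _)) // [d]splitr ltrD // (le_lt_trans k3).
- by rewrite (le_lt_trans (ler_distD x.2 _ _)) // [d]splitr ltrD // (le_lt_trans k4).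
Unshelve. all: by end_near. Qed.

(** On the grid of differences [e s - f t], two sides of the square carry the winding of [e] around
    the ends of [f]. The other two carry that of [f] around the ends of [e] up to sign, and the
    change of sign produces the terms in [upper]. *)
Lemma ray_index_disjoint (R : realType) (e f : R -> plane R) :
  {within `[0, 1], continuous e} -> {within `[0, 1], continuous f} ->
  (forall s t, s \in `[0, 1] -> t \in `[0, 1] -> e s != f t) ->
  \forall N \near \oo,
    ray_index N e (f 0) (+) ray_index N e (f 1) (+)
    ray_index N f (e 0) (+) ray_index N f (e 1) =
    upper (e 0 - f 0) (+) upper (e 0 - f 1) (+)
    upper (e 1 - f 0) (+) upper (e 1 - f 1).
Proof.
move=> ce cf disj; near=> N.
have cell : forall s t, s \in `[0, 1] -> t \in `[0, 1] ->
    exists b : bool, forall s1 t1 s2 t2,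
      s1 \in `[0, 1] -> t1 \in `[0, 1] -> s2 \in `[0, 1] -> t2 \in `[0, 1] ->
      `|s - s1| <= N.+1%:R^-1 -> `|t - t1| <= N.+1%:R^-1 ->
      `|s - s2| <= N.+1%:R^-1 -> `|t - t2| <= N.+1%:R^-1 ->
      tame b (e s1 - f t1) (e s2 - f t2).
  by near: N; exact: cell_cross.
pose p i : R := i%:R / N.+1%:R.
have p0 : p 0%N = 0 by rewrite /p mul0r.
have p1 : p N.+1 = 1 by rewrite /p divff.
have p01 i : (i <= N.+1)%N -> p i \in `[0, 1].
  by move=> iN; rewrite in_itv /= divr_ge0 // ler_pdivrMr // mul1r ler_nat.
have pd i : `|p i - p i| <= N.+1%:R^-1 by rewrite subrr normr0 invr_ge0.
have pS i : `|p i - p i.+1| <= N.+1%:R^-1.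
  by rewrite /p -mulrBl -natr1 opprD addNKr mulN1r normrN ger0_norm // invr_ge0.
pose z i j := e (p i) - f (p j).
pose h i j := ray_cross (z i j) (z i.+1 j).
pose v i j := ray_cross (z i j) (z i j.+1).
(* The booleans act as offsets 0 or 1 that select a corner of the cell. *)
have {cell} zcell i j : (i < N.+1)%N -> (j < N.+1)%N ->
    exists c : bool, forall a b a' b' : bool,
      tame c (z (a + i)%N (b + j)%N) (z (a' + i)%N (b' + j)%N).
  move=> iN jN; have [c H] := cell _ _ (p01 i (ltnW iN)) (p01 j (ltnW jN)).
  exists c => a b a' b'; apply: H.
  - by apply: p01; case: a => //; exact: ltnW.
  - by apply: p01; case: b => //; exact: ltnW.
  - by apply: p01; case: a' => //; exact: ltnW.
  - by apply: p01; case: b' => //; exact: ltnW.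
  - by case: a.
  - by case: b.
  - by case: a'.
  - by case: b'.
have hv i j : (i < N.+1)%N -> (j < N.+1)%N ->
    h i j (+) v i.+1 j = v i j (+) h i j.+1.
  move=> iN jN; have [c H] := zcell i j iN jN; rewrite /h /v.
  (* Both paths around the cell give [c] times the change of [upper] between the same two opposite
     corners. *)
  have [-> _ _] := H false false true false.
  have [-> _ _] := H true false true true.
  have [-> _ _] := H false false false true.
  have [-> _ _] := H false true true true.
  rewrite /= !add0n !add1n.
  by case: (c) => //=; do 4![case: upper].
have rv i : (i <= N.+1)%N ->
    ray_index N f (e (p i)) = \big[addb/false]_(j < N.+1) v i j (+)
      (upper (z i 0%N) (+) upper (z i N.+1)).
  move=> iN; rewrite /ray_index -/p.
  (* No cell starts at column [N.+1], so every column but the first is taken as the right side of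
     the preceding cell. *)
  have [c [d [dN cd]]] : exists (c : bool) d, (d < N.+1)%N /\ i = (c + d)%N.
    case: i iN => [|i] iN; first by exists false, 0%N.
    by exists true, i.
  have tel m : (m <= N.+1)%N ->
      \big[addb/false]_(j < m) ray_cross (f (p j) - e (p i)) (f (p j.+1) - e (p i))
      = \big[addb/false]_(j < m) v i j (+) (upper (z i 0%N) (+) upper (z i m)).
    elim: m => [|m IH] mN; first by rewrite !big_ord0 addbb.
    rewrite !big_ord_recr /= {}IH; last exact: ltnW.
    rewrite -(opprB (e (p i)) (f (p m))) -(opprB (e (p i)) (f (p m.+1))).
    have [k H] := zcell d m dN mN.
    have [_ z0 z01] := H c false c true.
    have [_ z1 _] := H c true c true.
    rewrite !add0n add1n -cd in z0 z01 z1.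
    rewrite (ray_crossN z0 z1 z01) -/(v i m) -/(z i m) -/(z i m.+1) /v.
    set b1 := \big[_/_]_(_ < _) _.
    by do ![case: upper; case: ray_cross | case: b1 | case: upper].
  exact: tel.
have := grid_boundary hv.
have -> : \big[addb/false]_(i < N.+1) h i 0%N = ray_index N e (f 0).
  by apply: eq_bigr => i _; rewrite /h /z p0.
have -> : \big[addb/false]_(i < N.+1) h i N.+1 = ray_index N e (f 1).
  by apply: eq_bigr => i _; rewrite /h /z p1.
have := rv 0%N isT; have := rv N.+1 (leqnn _); rewrite /z p0 p1 => -> ->.
set A := \big[_/_]_(_ < _) _; set B := \big[_/_]_(_ < _) _ => H.
move: H; case: A; case: B; case: (ray_index N e (f 0));
case: (ray_index N e (f 1)) => //=;
by do 4![case: upper].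
Unshelve. all: by end_near. Qed.

(** * Non-planarity of K_{3,3} *)

(* [inl i] and [inr j] stand for the vertices of the two sides of K_{3,3}, and
   [I i j x] for the parity of the winding of the edge ij around [x]. *)
Lemma ray_relations_absurd (I : 'I_3 -> 'I_3 -> 'I_3 + 'I_3 -> bool)
    (U : 'I_3 + 'I_3 -> 'I_3 + 'I_3 -> bool) :
  (forall x y, x != y -> U y x = ~~ U x y) ->
  ~ (forall i j k l, i != k -> j != l ->
    I i j (inl k) (+) I i j (inr l) (+) I k l (inl i) (+) I k l (inr j) =
    U (inl i) (inl k) (+) U (inl i) (inr l) (+)
    U (inr j) (inl k) (+) U (inr j) (inr l)).
Proof.
move=> UN rel.
(* From here on [bool] is the field with two elements. *)
have {}UN x y : x != y -> U y x = 1 + U x y by move/UN->; case: (U x y).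
pose o0 : 'I_3 := @Ordinal 3 0 isT.
pose o1 : 'I_3 := @Ordinal 3 1 isT.
pose o2 : 'I_3 := @Ordinal 3 2 isT.
pose lt3 := [:: (o0, o1); (o0, o2); (o1, o2)].
pose neq3 := lt3 ++ [:: (o1, o0); (o2, o0); (o2, o1)].
(* Ordering each pair of independent edges by [i < k] leaves 3 * 6 = 18 relations. *)
have : \sum_(x <- lt3) \sum_(y <- neq3)
    (I x.1 y.1 (inl x.2) + I x.1 y.1 (inr y.2) +
     I x.2 y.2 (inl x.1) + I x.2 y.2 (inr y.1)) =
  \sum_(x <- lt3) \sum_(y <- neq3)
    (U (inl x.1) (inl x.2) + U (inl x.1) (inr y.2) +
     U (inr y.1) (inl x.2) + U (inr y.1) (inr y.2)).
  rewrite big_seq [RHS]big_seq; apply: eq_bigr => -[i k] xs.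
  rewrite big_seq [RHS]big_seq; apply: eq_bigr => -[j l] ys; apply: rel.
    by move: xs; rewrite !inE => /or3P[] /eqP[-> ->].
  move: ys; rewrite !inE => H.
  by repeat (case/orP: H => [/eqP[-> ->]//|H]); case/eqP: H => -> ->.
have -> : \sum_(x <- lt3) \sum_(y <- neq3)
    (I x.1 y.1 (inl x.2) + I x.1 y.1 (inr y.2) +
     I x.2 y.2 (inl x.1) + I x.2 y.2 (inr y.1)) =
  (\sum_(x <- neq3) \sum_(j <- [:: o0; o1; o2])
    (I x.1 j (inl x.2) + I j x.1 (inr x.2))) *+ 2.
  by rewrite /neq3 /lt3 /= !big_cons !big_nil /=; ring.
(* Reorienting the terms yields 27 = 1 + 2 * 13 ones: 18 from [U (inr _) (inl _)] and 9 from
   [U (inr _) (inr _)]. *)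
have -> : \sum_(x <- lt3) \sum_(y <- neq3)
    (U (inl x.1) (inl x.2) + U (inl x.1) (inr y.2) +
     U (inr y.1) (inl x.2) + U (inr y.1) (inr y.2)) =
  1 + ((\sum_(x <- lt3) (U (inl x.1) (inl x.2) + U (inr x.1) (inr x.2))) *+ 3 +
   \sum_(i <- [:: o0; o1; o2]) \sum_(j <- [:: o0; o1; o2])
     U (inl i) (inr j) *+ 2 + 1 *+ 13) *+ 2.
  rewrite /neq3 /lt3 /= !big_cons !big_nil /= !(UN (inl _) (inr _)) //.
  rewrite (UN (inr o0) (inr o1)) // (UN (inr o0) (inr o2)) //.
  rewrite (UN (inr o1) (inr o2)) //.
  ring.
have dbl (x : bool) : x *+ 2 = 0 by case: x.
by rewrite !dbl.
Qed.

Lemma K33_crossing (R : realType) (c : 'I_3 -> 'I_3 -> R -> plane R)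
    (a b : 'I_3 -> plane R) :
  (forall i j, {within `[0, 1], continuous (c i j)}) ->
  (forall i j, c i j 0 = a i) -> (forall i j, c i j 1 = b j) ->
  exists i j k l s t, [/\ i != k, j != l, s \in `[0, 1], t \in `[0, 1] &
    c i j s = c k l t].
Proof.
move=> cc ca cb; apply: contrapT => noX.
have disj i j k l : i != k -> j != l -> forall s t,
    s \in `[0, 1] -> t \in `[0, 1] -> c i j s != c k l t.
  move=> ik jl s t hs ht; apply/eqP => E.
  by apply: noX; exists i, j, k, l, s, t.
pose pt x := match x with inl i => a i | inr j => b j end.
have in0 : (0 : R) \in `[0, 1] by rewrite in_itv /= lexx ler01.
have in1 : (1 : R) \in `[0, 1] by rewrite in_itv /= lexx ler01.
have other (i : 'I_3) : exists k, i != k.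
  by case: (eqVneq i 0) => [->|]; [exists 1 | exists 0].
(* Any two vertices of K_{3,3} are ends of two independent edges, which are disjoint here. *)
have pt_inj x y : x != y -> pt x - pt y != 0.
  rewrite subr_eq0; case: x y => [i|j] [k|l] /= => [ik|_|_|jl].
  - by rewrite -(ca i 0) -(ca k 1); exact: disj.
  - have [k ik] := other i; have [j jl] := other l.
    by rewrite -(ca i j) -(cb k l); apply: disj => //; rewrite eq_sym.
  - have [i ik] := other k; have [l jl] := other j.
    by rewrite -(ca k l) -(cb i j); apply: disj => //; rewrite eq_sym.
  - by rewrite -(cb 0 j) -(cb 1 l); exact: disj.
have : \forall N \near \oo, forall i j k l : 'I_3, i != k -> j != l ->
    ray_index N (c i j) (a k) (+) ray_index N (c i j) (b l) (+)
    ray_index N (c k l) (a i) (+) ray_index N (c k l) (b j) =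
    upper (a i - a k) (+) upper (a i - b l) (+)
    upper (b j - a k) (+) upper (b j - b l).
  do 4!apply: filter_forall => ?.
  have [ik|_] := boolP (_ != _); last exact: nearW.
  have [jl|_] := boolP (_ != _); last exact: nearW.
  have := ray_index_disjoint (cc _ _) (cc _ _) (disj _ _ _ _ ik jl).
  by rewrite !ca !cb; apply: filterS.
case=> N _ /(_ N (leqnn N)) rel.
apply: (@ray_relations_absurd (fun i j x => ray_index N (c i j) (pt x))
          (fun x y => upper (pt x - pt y))) => //.
by move=> x y xy; rewrite -opprB upperN // pt_inj.
Qed.

(** * Mantel's theorem and its complementary form *)

(** Edges are counted twice in the double sum; loops are excluded by the case [x = y = z] of the
    second hypothesis. *)
Lemma mantel (T : finType) (g : rel T) : symmetric g ->
  (forall x y z, g x y -> g y z -> ~~ g x z) ->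
  ((\sum_x \sum_y g x y) * 2 <= #|T| ^ 2)%N.
Proof.
move=> gC tri; case: (pickP T) => [x0 _|T0]; last by rewrite big_pred0.
pose d x := (\sum_y g x y)%N.
(* The neighbours of a vertex v of maximal degree are pairwise non-adjacent,
   so every edge has an end outside them. *)
have [v _ vmax] : {v | true & forall x, (d x <= d v)%N}.
  by case: (@arg_maxnP T x0 predT d isT) => v _ h; exists v => // x; exact: h.
have split x y : (g x y <= (~~ g v x) * g x y + (~~ g v y) * g x y)%N.
  have := @tri v x y; case: (g v x); case: (g v y); case: (g x y) => //=.
  by move=> /(_ isT isT).
have bound : (\sum_(x | ~~ g v x) d x <= (#|T| - d v) * d v)%N.
  apply: leq_trans (_ : (\sum_(x | ~~ g v x) d v <= _)%N).
    by apply: leq_sum => x _.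
  rewrite sum_nat_const; apply: leq_mul => //.
  have -> : d v = #|[pred y | g v y]|.
    rewrite /d -sum1_card [RHS]big_mkcond /=; apply: eq_bigr => y _.
    by rewrite inE; case: (g v y).
  by rewrite -(cardC [pred y | g v y]) addKn.
have : (\sum_x \sum_y g x y <= (#|T| - d v) * d v + (#|T| - d v) * d v)%N.
  apply: leq_trans (_ : (\sum_x \sum_y ((~~ g v x) * g x y + (~~ g v y) * g x y) <= _)%N).
    by apply: leq_sum => x _; apply: leq_sum => y _; exact: split.
  under eq_bigr do rewrite big_split /=.
  rewrite big_split /=; apply: leq_add.
    apply: leq_trans bound; rewrite [leqRHS]big_mkcond /=; apply: leq_sum => x _.
    by rewrite -big_distrr /=; case: (g v x); rewrite //= mul1n.
  rewrite exchange_big /=.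
  apply: leq_trans bound; rewrite [leqRHS]big_mkcond /=; apply: leq_sum => x _.
  rewrite -big_distrr /=; case: (g v x); rewrite //= mul1n.
  by apply: leq_sum => y _; rewrite gC.
have := nat_AGM2 (#|T| - d v) (d v).
have dT : (d v <= #|T|)%N.
  by rewrite -sum1_card; apply: leq_sum => y _; case: (g v y).
rewrite subnK //; move: ((#|T| - d v) * d v)%N (#|T| ^ 2)%N (\sum_x _)%N.
by move=> P Q S [+ _]; lia.
Qed.

(** Ordered pairs split into [c], its loopless complement [g], which is triangle-free, and the
    diagonal, which causes the linear term. *)
Lemma mantel_complement (T : finType) (c : rel T) : symmetric c ->
  (forall x y z, x != y -> y != z -> x != z -> [|| c x y, c y z | c x z]) ->
  (#|T| ^ 2 <= (\sum_x \sum_y c x y) * 2 + #|T| * 2)%N.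
Proof.
move=> cC tri; pose g x y := (x != y) && ~~ c x y.
have gC : symmetric g by move=> x y; rewrite /g eq_sym cC.
have gtri x y z : g x y -> g y z -> ~~ g x z.
  move=> /andP[xy nxy] /andP[yz nyz]; apply/negP => /andP[xz nxz].
  by have := tri x y z xy yz xz; rewrite (negPf nxy) (negPf nyz) (negPf nxz).
have := mantel gC gtri.
have : (\sum_(x : T) \sum_(y : T) 1 <=
    \sum_x \sum_y g x y + (\sum_x \sum_y c x y + \sum_(x : T) \sum_(y : T) (x == y)))%N.
  rewrite -!big_split /=; apply: leq_sum => x _.
  rewrite -!big_split /=; apply: leq_sum => y _.
  by rewrite /g; case: (x == y); case: (c x y).
have -> : (\sum_(x : T) \sum_(y : T) 1 = #|T| ^ 2)%N.
  by under eq_bigr do rewrite sum1_card; rewrite sum_nat_const expnS expn1.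
have -> : (\sum_(x : T) \sum_(y : T) (x == y) = #|T|)%N.
  rewrite -sum1_card; apply: eq_bigr => x _.
  by rewrite (bigD1 x) //= eqxx big1 // => y; rewrite eq_sym => /negPf->.
lia.
Qed.

(** * Meeting edges in a drawing and the crossing number *)

Lemma set2_eq (T : finType) (x y z w : T) :
  ([set x; y] == [set z; w])%SET = ((x == z) && (y == w)) || ((x == w) && (y == z)).
Proof.
apply/eqP/idP => [E|/orP[]/andP[/eqP-> /eqP->]//]; last by rewrite finset.setUC.
have hx : x \in [set z; w]%SET by rewrite -E set21.
have hy : y \in [set z; w]%SET by rewrite -E set22.
have hz : z \in [set x; y]%SET by rewrite E set21.
have hw : w \in [set x; y]%SET by rewrite E set22.
move: hx hy hz hw; rewrite !inE !(eq_sym z) !(eq_sym w).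
by case: (x == z); case: (x == w); case: (y == z); case: (y == w).
Qed.

(** Symmetric, and false for [E = F]: a sum over ordered pairs counts every meeting pair twice. *)
Definition edges_meet (R : realType) (V : finType) (e : rel V)
    (D : drawing R e) (E F : {set V}) : bool :=
  `[< exists p, meet_at D E F p >].

Lemma edges_meetC (R : realType) (V : finType) (e : rel V)
    (D : drawing R e) (E F : {set V}) : edges_meet D E F = edges_meet D F E.
Proof.
by apply/asboolP/asboolP => -[p [? ? ? ? []]]; exists p; split=> //; rewrite eq_sym.
Qed.

Lemma mem_edges (V : finType) (e : rel V) (u v : V) :
  e u v -> ([set u; v] \in edges e)%SET.
Proof. by move=> uv; apply/imsetP; exists (u, v); rewrite ?inE. Qed.

Lemma K33_meet (R : realType) (V : finType) (e : rel V) (D : drawing R e)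
    (u w : 'I_3 -> V) :
  injective u -> injective w -> (forall i j, e (u i) (w j)) ->
  irreflexive e ->
  exists i j k l, [/\ i != k, j != l &
    edges_meet D [set u i; w j]%SET [set u k; w l]%SET].
Proof.
move=> uI wI euw eI.
have uw i j : u i != w j by apply: contraTneq (euw i j) => ->; rewrite eI.
pose c i j := projT1 (cid (edge_curve_arc D (euw i j))).
have cP i j := projT2 (cid (edge_curve_arc D (euw i j))).
have [i [j [k [l [s [t [ik jl hs ht E]]]]]]] :=
  @K33_crossing R c (vertex_point D \o u) (vertex_point D \o w)
    (fun i j => let: And5 h _ _ _ _ := cP i j in h)
    (fun i j => let: And5 _ _ h _ _ := cP i j in h)
    (fun i j => let: And5 _ _ _ h _ := cP i j in h).
exists i, j, k, l; split=> //; apply/asboolP; exists (c i j s).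
have on_curve i' j' t' : t' \in `[0, 1] ->
    edge_curve D [set u i'; w j']%SET (c i' j' t').
  by case: (cP i' j') => _ _ _ _ <- ht'; exists t'.
have dE : edge_curve D [set u i; w j]%SET (c i j s) by exact: on_curve.
have dF : edge_curve D [set u k; w l]%SET (c i j s) by rewrite E; exact: on_curve.
split=> //; try exact: mem_edges.
  by rewrite set2_eq (inj_eq uI) (inj_eq wI) (negPf ik) (negPf (uw _ _)).
(* A vertex at the common point would be an end of both edges, which are independent. *)
move=> [x _ xp]; rewrite -xp in dE dF.
have := edge_curve_vertex (mem_edges (euw i j)) dE.
have := edge_curve_vertex (mem_edges (euw k l)) dF.
rewrite !inE => /orP[]/eqP-> /orP[].
- by rewrite (inj_eq uI) eq_sym (negPf ik).
- by rewrite (negPf (uw _ _)).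
- by rewrite eq_sym (negPf (uw _ _)).
- by rewrite (inj_eq wI) eq_sym (negPf jl).
Qed.

Lemma meeting_pairs_le (R : realType) (V : finType) (e : rel V)
    (D : drawing R e) (J : finType) (edge : J -> {set V}) :
  good_drawing D -> injective edge ->
  (((\sum_x \sum_y edges_meet D (edge x) (edge y))%N)%:R%:E <=
    2%:E * cr_drawing D)%E.
Proof.
move=> [two _ _ _] eI; rewrite /cr_drawing /counting.
(* With infinitely many crossing points the right-hand side is infinite. *)
case: asboolP => [finP|_]; last by rewrite gt0_muley ?leey // lte_fin.
rewrite -EFinM lee_fin -natrM ler_nat.
set P := [set _ | _] in finP *.
pose X := [set x : J * J | edges_meet D (edge x.1) (edge x.2)]%SET.
pose pt (x : J * J) : plane R := get (fun p => meet_at D (edge x.1) (edge x.2) p).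
have ptP x : x \in X -> meet_at D (edge x.1) (edge x.2) (pt x).
  by rewrite inE => /asboolP; exact: getPex.
(* At most two edges pass through [pt x], so [x] is known from [pt x] up to
   the order of its two entries. *)
pose f (x : J * J) := (enum_rank x.1 < enum_rank x.2, pt x)%N.
have -> : (\sum_x \sum_y edges_meet D (edge x) (edge y) = size (map f (enum X)))%N.
  rewrite size_map -cardE -sum1_card pair_big /= [RHS]big_mkcond /=.
  by apply: eq_bigr => x _; rewrite inE; case: edges_meet.
have -> : (2 * #|` fset_set P |%fset =
    size [seq (b, p) | b <- [:: true; false], p <- (fset_set P : seq _)])%N.
  by rewrite size_allpairs.
apply: uniq_leq_size.
  rewrite map_inj_in_uniq ?enum_uniq // => -[x y] [x' y'].
  rewrite !mem_enum => xX x'X [] b pE.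
  have := ptP _ xX; have := ptP _ x'X; rewrite -pE /=; set p := pt _ => m' m.
  (* A third edge of the family through [p] would violate the first clause of [good_drawing]. *)
  have in2 z z' : meet_at D (edge z) (edge z') p -> z \in [:: x; y].
    move=> mz; rewrite !inE; apply/norP => -[/negPf zx /negPf zy].
    case: mz m => zE _ _ _ [pz _] [xE yE xy pv [px py]].
    suff /eI/eqP : edge x = edge z by rewrite eq_sym zx.
    apply: (two _ (edge y) _ p); first by split.
    by split=> //; apply/eqP => /eI yz; rewrite yz eqxx in zy.
  have := in2 _ _ m'.
  have : y' \in [:: x; y].
    by apply: (in2 _ x'); case: m' => ? ? ? ? []; split=> //; rewrite eq_sym.
  have neq z z' : meet_at D (edge z) (edge z') p -> z != z'.
    by case=> _ _ + _ _; apply: contra => /eqP->.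
  move: (neq _ _ m) (neq _ _ m') b; rewrite !inE => xy xy' b.
  move=> /orP[]/eqP y'E /orP[]/eqP x'E; subst x' y'; rewrite ?eqxx // in xy' b *.
  have /eqP : enum_rank x != enum_rank y :> nat.
    by apply: contra xy => /eqP/val_inj/enum_rank_inj->.
  move: b; case: ltngtP => //.
move=> _ /mapP[x xX ->]; apply/allpairsP; exists (f x); split=> //=.
  by case: (_ < _)%N.
rewrite mem_enum in xX; rewrite in_fset_set //; apply: mem_set.
by exists (edge x.1), (edge x.2); exact: ptP.
Qed.

(** * Counting crossings between stars in K_{n,n,n} *)

(** Here [c a b] says that the stars at [a] and [b] meet along edges with distinct leaves. By
    [K33_meet], this happens for two of any three centres, so [mantel_complement] applies. *)
Lemma star_crossings (R : realType) (n : nat) (D : drawing R (@complete_tripartite n))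
    (i : 'I_3) (w : 'I_3 -> 'I_3 * 'I_n) :
  injective w -> (forall m, (w m).1 != i) ->
  (n ^ 2 <= (\sum_(p < 3) \sum_(q < 3 | q != p) \sum_a \sum_b
     edges_meet D [set (i, a); w p]%SET [set (i, b); w q]%SET) * 2 + n * 2)%N.
Proof.
move=> wI wi.
pose c (a b : 'I_n) := [exists p, [exists (q | q != p),
  edges_meet D [set (i, a); w p]%SET [set (i, b); w q]%SET]].
have cC : symmetric c.
  have h a b : c a b -> c b a.
    move=> /existsP[p /existsP[q /andP[qp H]]].
    apply/existsP; exists q; apply/existsP; exists p.
    by rewrite eq_sym qp edges_meetC.
  by move=> a b; apply/idP/idP; exact: h.
have bound := @mantel_complement _ c cC; rewrite card_ord in bound.
apply: leq_trans (bound _) _.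
  move=> x y z xy yz xz.
  pose u (m : 'I_3) : 'I_3 * 'I_n := (i, tnth [tuple x; y; z] m).
  have uI : injective u.
    move=> m m' [E]; apply: (elimT (tuple_uniqP [tuple x; y; z])) E.
    by rewrite /= !inE negb_or xy xz yz.
  have [||m [p [m' [q [mm' pq H]]]]] := K33_meet D uI wI.
  - by move=> m m'; rewrite /complete_tripartite /= eq_sym wi.
  - by move=> v; rewrite /complete_tripartite eqxx.
  have {H} : c (u m).2 (u m').2.
    by apply/existsP; exists p; apply/existsP; exists q; rewrite eq_sym pq.
  case: m m' mm' => [[|[|[|//]]] ?] [[|[|[|//]]] ?] //= _; rewrite !(tnth_nth x) /=;
    by [move=> ->; rewrite ?orbT | rewrite cC => ->; rewrite ?orbT].
rewrite leq_add2r leq_mul2r /=.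
under [leqRHS]eq_bigr do rewrite exchange_big /=.
rewrite [leqRHS]exchange_big /=; apply: leq_sum => a _.
under [leqRHS]eq_bigr do rewrite exchange_big /=.
rewrite [leqRHS]exchange_big /=; apply: leq_sum => b _.
have [/existsP[p /existsP[q /andP[qp H]]]|//] := boolP (c a b).
by rewrite (bigD1 p) //= (bigD1 q) //= H.
Qed.

Definition class_meets (R : realType) (n : nat)
    (D : drawing R (@complete_tripartite n)) (P Q : 'I_3 * 'I_3) : nat :=
  (\sum_a \sum_x \sum_b \sum_y edges_meet D
     [set (P.1, a); (P.2, x)]%SET [set (Q.1, b); (Q.2, y)]%SET)%N.

Lemma class_meets_swapl (R : realType) (n : nat)
    (D : drawing R (@complete_tripartite n)) (i j : 'I_3) (Q : 'I_3 * 'I_3) :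
  class_meets D (i, j) Q = class_meets D (j, i) Q.
Proof.
rewrite /class_meets exchange_big; apply: eq_bigr => x _; apply: eq_bigr => a _.
by rewrite finset.setUC.
Qed.

Lemma class_meets_swapr (R : realType) (n : nat)
    (D : drawing R (@complete_tripartite n)) (P : 'I_3 * 'I_3) (i j : 'I_3) :
  class_meets D P (i, j) = class_meets D P (j, i).
Proof.
rewrite /class_meets; apply: eq_bigr => a _; apply: eq_bigr => x _.
rewrite exchange_big; apply: eq_bigr => y _; apply: eq_bigr => b _.
by congr (nat_of_bool (edges_meet _ _ _)); rewrite finset.setUC.
Qed.

(** [star_crossings] is summed over two distinct leaves in [j] and one in [k]. Each term ignores one
    leaf, whence a common factor [n] that is divided out; the 4 is the 2 of [star_crossings] times
    the two roles of the leaves in [j]. *)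
Lemma star_count (R : realType) (n : nat)
    (D : drawing R (@complete_tripartite n)) (i j k : 'I_3) :
  i != j -> i != k -> j != k -> (0 < n)%N ->
  (n ^ 3 * n.-1 <= (class_meets D (i, j) (i, j) + class_meets D (i, j) (i, k) +
     class_meets D (i, k) (i, j)) * 4 + n ^ 2 * n.-1 * 2)%N.
Proof.
move=> ij ik jk n0.
pose S u v := (\sum_a \sum_b edges_meet D [set (i, a); u]%SET [set (i, b); v]%SET)%N.
have SE p q : (\sum_x \sum_y S (p, x) (q, y) = class_meets D (i, p) (i, q))%N.
  rewrite /class_meets /S /= [RHS]exchange_big /=; apply: eq_bigr => x _.
  rewrite exchange_big /=; apply: eq_bigr => a _.
  by rewrite exchange_big.
have star x y z : y != x ->
    (n ^ 2 <= (S (j, x) (j, y) + S (j, x) (k, z) + S (j, y) (j, x) +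
       S (j, y) (k, z) + S (k, z) (j, x) + S (k, z) (j, y)) * 2 + n * 2)%N.
  move=> yx.
  pose w (m : 'I_3) := tnth [tuple (j, x); (j, y); (k, z)] m.
  have wI : injective w.
    apply/tuple_uniqP; rewrite /= !inE !xpair_eqE eqxx (negPf jk) /=.
    by rewrite orbF eq_sym yx.
  have wi m : (w m).1 != i.
    by case: m => [[|[|[|//]]] ?]; rewrite /w !(tnth_nth (j, x)) /= eq_sym.
  have := star_crossings D wI wi.
  under eq_bigr do rewrite big_mkcond !big_ord_recl big_ord0.
  rewrite !big_ord_recl big_ord0 /w !(tnth_nth (j, x)) /= -!/(S _ _).
  lia.
have : (\sum_(x < n) \sum_(y < n | y != x) \sum_(z < n) n ^ 2 <=
   \sum_(x < n) \sum_(y < n | y != x) \sum_(z < n)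
    ((S (j, x) (j, y) + S (j, x) (k, z) + S (j, y) (j, x) +
       S (j, y) (k, z) + S (k, z) (j, x) + S (k, z) (j, y)) * 2 + n * 2))%N.
  apply: leq_sum => x _; apply: leq_sum => y yx; apply: leq_sum => z _.
  exact: star.
have cst c : (\sum_(x < n) \sum_(y < n | y != x) \sum_(z < n) c =
    n * (n.-1 * (n * c)))%N.
  transitivity (\sum_(x < n) n.-1 * (n * c))%N; last first.
    by rewrite sum_nat_const card_ord.
  apply: eq_bigr => x _; rewrite (eq_bigr (fun _ => n * c)%N) => [|y _].
    rewrite sum_nat_const; congr (_ * _)%N; have := cardC1 x; rewrite card_ord => <-.
    by apply: eq_card => y; rewrite !inE.
  by rewrite sum_nat_const card_ord.
rewrite cst.
have -> : (\sum_(x < n) \sum_(y < n | y != x) \sum_(z < n)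
    ((S (j, x) (j, y) + S (j, x) (k, z) + S (j, y) (j, x) +
       S (j, y) (k, z) + S (k, z) (j, x) + S (k, z) (j, y)) * 2 + n * 2) =
   \sum_(x < n) \sum_(y < n | y != x) \sum_(z < n)
    ((S (j, x) (j, y) + S (j, x) (k, z) + S (j, y) (j, x) +
       S (j, y) (k, z) + S (k, z) (j, x) + S (k, z) (j, y)) * 2) +
   n * (n.-1 * (n * (n * 2))))%N.
  rewrite -cst -big_split; apply: eq_bigr => x _.
  by rewrite -big_split; apply: eq_bigr => y _; rewrite -big_split.
(* Admitting [y = x] only enlarges the upper bound and makes the sums factor. *)
have drop : (\sum_(x < n) \sum_(y < n | y != x) \sum_(z < n)
    ((S (j, x) (j, y) + S (j, x) (k, z) + S (j, y) (j, x) +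
       S (j, y) (k, z) + S (k, z) (j, x) + S (k, z) (j, y)) * 2) <=
   \sum_(x < n) \sum_(y < n) \sum_(z < n)
    ((S (j, x) (j, y) + S (j, x) (k, z) + S (j, y) (j, x) +
       S (j, y) (k, z) + S (k, z) (j, x) + S (k, z) (j, y)) * 2))%N.
  by apply: leq_sum => x _; rewrite big_mkcond; apply: leq_sum => y _; case: ifP.
have full : (\sum_(x < n) \sum_(y < n) \sum_(z < n)
    ((S (j, x) (j, y) + S (j, x) (k, z) + S (j, y) (j, x) +
       S (j, y) (k, z) + S (k, z) (j, x) + S (k, z) (j, y)) * 2) =
   n * ((class_meets D (i, j) (i, j) + class_meets D (i, j) (i, k) +
     class_meets D (i, k) (i, j)) * 4))%N.
  have c1 (F : 'I_n -> 'I_n -> nat) : (\sum_x \sum_y \sum_(z < n) F x y =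
      n * \sum_x \sum_y F x y)%N.
    rewrite big_distrr; apply: eq_bigr => x _; rewrite big_distrr.
    by apply: eq_bigr => y _; rewrite sum_nat_const card_ord.
  have c2 (F : 'I_n -> 'I_n -> nat) : (\sum_x \sum_(y < n) \sum_z F x z =
      n * \sum_x \sum_z F x z)%N.
    by rewrite -c1; apply: eq_bigr => x _; rewrite exchange_big.
  have c3 (F : 'I_n -> 'I_n -> nat) : (\sum_(x < n) \sum_y \sum_z F y z =
      n * \sum_y \sum_z F y z)%N.
    by rewrite sum_nat_const card_ord.
  transitivity (2 * (\sum_x \sum_y \sum_(z < n) S (j, x) (j, y) +
     \sum_x \sum_(y < n) \sum_z S (j, x) (k, z) +
     \sum_x \sum_y \sum_(z < n) S (j, y) (j, x) +
     \sum_(x < n) \sum_y \sum_z S (j, y) (k, z) +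
     \sum_x \sum_(y < n) \sum_z S (k, z) (j, x) +
     \sum_(x < n) \sum_y \sum_z S (k, z) (j, y)))%N.
    rewrite mulnC -!big_split /= big_distrl; apply: eq_bigr => x _.
    rewrite -!big_split /= big_distrl; apply: eq_bigr => y _.
    by rewrite -!big_split /= big_distrl.
  rewrite (c1 (fun x y => S (j, x) (j, y))) (c1 (fun x y => S (j, y) (j, x))).
  rewrite (c2 (fun x z => S (j, x) (k, z))) (c2 (fun x z => S (k, z) (j, x))).
  rewrite (c3 (fun x z => S (j, x) (k, z))) (c3 (fun x z => S (k, z) (j, x))).
  have SE' p q : (\sum_x \sum_y S (p, y) (q, x) = class_meets D (i, p) (i, q))%N.
    by rewrite exchange_big SE.
  rewrite !SE !SE'.
  ring.
move=> H; have {H} := leq_trans H (leq_add drop (leqnn _)).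
rewrite full -mulnDr leq_pmul2l //.
have -> : (n.-1 * (n * n ^ 2) = n ^ 3 * n.-1)%N by ring.
have -> : (n.-1 * (n * (n * 2)) = n ^ 2 * n.-1 * 2)%N by ring.
done.
Qed.

(** One orientation for each pair of partite sets, so that [class_edge] lists every edge once. The
    default is never read, as [s < 3]. *)
Definition class_ends (s : 'I_3) : 'I_3 * 'I_3 :=
  nth (0, 1) [:: (0, 1); (0, 2%:R); (1, 2%:R)] s.

Definition class_edge (n : nat) (x : 'I_3 * ('I_n * 'I_n)) : {set 'I_3 * 'I_n} :=
  [set ((class_ends x.1).1, x.2.1); ((class_ends x.1).2, x.2.2)]%SET.

Lemma class_edge_inj (n : nat) : injective (@class_edge n).
Proof.
move=> [s [a x]] [t [b y]] /eqP; rewrite /class_edge set2_eq !xpair_eqE /=.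
case: s t => [[|[|[|//]]] hs] [[|[|[|//]]] ht]; rewrite /class_ends //= ?eqxx.
all: rewrite ?orbF ?andbF // => /andP[/eqP-> /eqP->].
all: by congr (_, _); apply: val_inj.
Qed.

(** Adding [star_count] over the six orders of the partite sets gives each of the nine ordered pairs
    of classes weight 2 * 4 = 8: equal classes arise from either end as centre, distinct ones from
    their common partite set in two orders. *)
Lemma crossing_pairs_bound (R : realType) (n : nat)
    (D : drawing R (@complete_tripartite n)) : (0 < n)%N ->
  (6 * (n ^ 3 * n.-1) <= 8 * \sum_x \sum_y
     edges_meet D (class_edge x) (class_edge y) + 12 * (n ^ 2 * n.-1))%N.
Proof.
move=> n0; have -> : (\sum_x \sum_y edges_meet D (class_edge x) (class_edge y) =
    \sum_s \sum_t class_meets D (class_ends s) (class_ends t))%N.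
  have sumE (F : 'I_3 * ('I_n * 'I_n) -> nat) :
      (\sum_x F x = \sum_s \sum_a \sum_b F (s, (a, b)))%N.
    under [RHS]eq_bigr do rewrite pair_bigA.
    by rewrite pair_bigA; apply: eq_bigr => -[s [a b]] _.
  rewrite sumE; apply: eq_bigr => s _.
  under eq_bigr do under eq_bigr do rewrite sumE.
  under eq_bigr do rewrite exchange_big.
  by rewrite exchange_big.
rewrite !big_ord_recl !big_ord0 /class_ends /=.
pose o0 : 'I_3 := 0; pose o1 : 'I_3 := 1; pose o2 : 'I_3 := 2%:R.
have := @star_count R n D o0 o1 o2 isT isT isT n0.
have := @star_count R n D o0 o2 o1 isT isT isT n0.
have := @star_count R n D o1 o0 o2 isT isT isT n0.
have := @star_count R n D o1 o2 o0 isT isT isT n0.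
have := @star_count R n D o2 o0 o1 isT isT isT n0.
have := @star_count R n D o2 o1 o0 isT isT isT n0.
rewrite !(class_meets_swapl D o1 o0, class_meets_swapl D o2 o0, class_meets_swapl D o2 o1).
rewrite !(class_meets_swapr D _ o1 o0, class_meets_swapr D _ o2 o0, class_meets_swapr D _ o2 o1).
rewrite -/o0 -/o1 -/o2.
move: (n ^ 3 * n.-1)%N (n ^ 2 * n.-1)%N; lia.
Qed.

(** * Comparison with A(n,n,n) *)

(** Each of the three terms is at most n^4/16 + n^4/8. *)
Lemma A_diag_le (n : nat) : (16 * A n n n <= 9 * n ^ 4)%N.
Proof.
have h : (4 * half_prod n <= n * n)%N.
  rewrite /half_prod; have := half_leq (leq_pred n).
  have := odd_double_half n; rewrite -muln2; nia.
have h2 : (2 * (n * n)./2 <= n * n)%N.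
  by have := odd_double_half (n * n); rewrite -muln2; lia.
have e4 : (n ^ 4 = (n * n) * (n * n))%N by rewrite !expnS expn0; ring.
rewrite /A /A_term e4; move: (half_prod n) (n * n)./2 (n * n)%N h h2 => p q m; nia.
Qed.

Lemma quartic_comparison (R : realFieldType) (x s a : R) : 2999 <= x ->
  6 * ((x + 1) ^+ 3 * x) <= 8 * s + 12 * ((x + 1) ^+ 2 * x) ->
  16 * a <= 9 * (x + 1) ^+ 4 ->
  666 / 1000 * a <= s / 2.
Proof.
move=> x0 B C.
have y0 : 0 <= (x + 1) ^+ 2 by exact: sqr_ge0.
have xx : 0 <= (x - 2999) * x by apply: mulr_ge0; lra.
(* The factor 5994/1000 is 9 * 666/1000. The inequality amounts to x^2 - 2998 x - 999 >= 0, which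
   holds from 2999 on. *)
have K : 5994 / 1000 * (x + 1) ^+ 2 <= 6 * (x * (x - 1)) by lra.
have {}K := ler_wpM2l y0 K.
have e4 : (x + 1) ^+ 4 = (x + 1) ^+ 2 * (x + 1) ^+ 2 by rewrite -exprD.
have e3 : (x + 1) ^+ 3 = (x + 1) ^+ 2 * (x + 1) by rewrite -exprSr.
rewrite e4 in C; rewrite e3 in B.
clear e3 e4 xx y0 x0.
move: ((x + 1) ^+ 2) K B C => y K B C.
lra.
Qed.

Theorem theorem1p2 (R : realType) :
  exists N : nat, forall n : nat, (N <= n)%N ->
    ((666 / 1000 * (A n n n)%:R)%:E <=
       crossing_number R (@complete_tripartite n))%E.
Proof.
exists 3000%N => n n3000; apply: le_ereal_inf_tmp => _ [D gD <-].
have n0 : (0 < n)%N by apply: leq_trans n3000.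
have B := crossing_pairs_bound D n0.
have C := meeting_pairs_le gD (@class_edge_inj n).
move: B C (A_diag_le n); set S := (\sum_x _)%N; move=> B C HA.
(* [S] counts ordered pairs, so half of it bounds the crossings from below. *)
apply: (@le_trans _ _ ((S%:R / 2)%:E)).
  rewrite lee_fin.
  case: n n0 n3000 D gD S B HA {C} => // m _ m3000 D gD S B HA.
  have {}B : 6 * ((m%:R + 1) ^+ 3 * m%:R) <=
      8 * S%:R + 12 * ((m%:R + 1) ^+ 2 * m%:R) :> R.
    by move: B; rewrite -(ler_nat R) !(natrD, natrM, natrX) /= -(natr1 m).
  have {}HA : 16 * (A m.+1 m.+1 m.+1)%:R <= 9 * (m%:R + 1) ^+ 4 :> R.
    by move: HA; rewrite -(ler_nat R) !(natrM, natrX) -(natr1 m).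
  have {}m3000 : 2999 <= m%:R :> R by rewrite ler_nat.
  exact: (quartic_comparison m3000 B HA).
rewrite -(@lee_pmul2l _ 2%:E) ?lte_fin // -EFinM.
by rewrite mulrC divfK ?pnatr_eq0.
Qed.
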